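(* Let $\mathbb{K}$ be an algebraically closed field of characteristic zero, let $n\ge 2$, and let $W_n=W_n(\mathbb{K})$ be written as the direct sum of the homogeneous components of its standard grading, $W_n=W_n^{[-1]}\oplus W_n^{[0]}\oplus\dots\oplus W_n^{[m]}\oplus\cdots$. Then $L=W_n^{[0]}$ is a Lie subalgebra of $W_n$, $L\simeq\mathfrak{gl}_n(\mathbb{K})$, and every summand $W_n^{[m]}$, $m\ge -1$, is a finite-dimensional module over $L$. Moreover, for every $m\ge 0$ the $L$-module $W_n^{[m]}$ is a direct sum $W_n^{[m]}=M_m\oplus N_m$ of two irreducible $L$-submodules, where $M_m$ consists of all derivations $D\in W_n^{[m]}$ with $\operatorname{div} D=0$, and $N_m$ consists of all derivations in $W_n^{[m]}$ of the form $fE_n$ with $f\in\mathbb{K}[x_1,\dots,x_n]$.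
   Context: $W_n=W_n(\mathbb{K})$ is the Lie algebra, under the commutator, of all $\mathbb{K}$-derivations of the polynomial ring $A=\mathbb{K}[x_1,\dots,x_n]$; each element is uniquely $D=\sum_{i=1}^n f_i\frac{\partial}{\partial x_i}$ with $f_i\in A$. For $j\ge -1$, $W_n^{[j]}$ is the $\mathbb{K}$-subspace of all $D=\sum_i f_i\frac{\partial}{\partial x_i}$ in which each $f_i$ is either zero or a homogeneous polynomial of degree $j+1$; this gives the standard grading $W_n=\bigoplus_{j\ge -1}W_n^{[j]}$. The subspace $W_n^{[0]}$ consists of the derivations $\sum_{i,j=1}^n a_{ij}x_i\frac{\partial}{\partial x_j}$ with $a_{ij}\in\mathbb{K}$, and it acts on each $W_n^{[m]}$ by the Lie bracket of $W_n$. The divergence of $D=\sum_i f_i\frac{\partial}{\partial x_i}$ is $\operatorname{div}D=\sum_i\frac{\partial f_i}{\partial x_i}$. The Euler derivation is $E_n=\sum_{i=1}^n x_i\frac{\partial}{\partial x_i}$. *)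

(* Defs.v *)
From HB Require Import structures.
From mathcomp Require Import all_boot all_order all_algebra.
From mathcomp Require Import mpoly ring.
From Stdlib Require Import FunctionalExtensionality ProofIrrelevance.

Set Implicit Arguments.
Unset Strict Implicit.
Unset Printing Implicit Defensive.

Import Order.TTheory GRing.Theory Num.Theory.
Local Open Scope ring_scope.

HB.mixin Record Lmodule_isLieAlgebra (R : comNzRingType) V
    of GRing.Lmodule R V := {
  lie : V -> V -> V;
  lie_linearl : forall v, linear (lie^~ v);
  lie_linearr : forall u, linear (lie u);
  lie_alt : forall u, lie u u = 0;
  lie_jacobi : forall u v w,
    lie u (lie v w) + lie v (lie w u) + lie w (lie u v) = 0
}.

#[short(type="lieAlgType")]
HB.structure Definition LieAlgebra (R : comNzRingType) :=
  { V of Lmodule_isLieAlgebra R V & GRing.Lmodule R V }.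

(* Subspaces are arbitrary [Prop]-valued predicates: the ambient spaces below
   are infinite-dimensional, so that [{vspace V}] is not available. *)
Section Subspaces.
Variables (R : comNzRingType) (V : lmodType R).
Implicit Types S T U : V -> Prop.

Definition subspace S : Prop :=
  S 0 /\ forall (a : R) u v, S u -> S v -> S (a *: u + v).

Definition finite_dimensional S : Prop :=
  exists (d : nat) (b : 'I_d -> V),
    (forall i, S (b i)) /\
    forall v, S v -> exists c : 'I_d -> R, v = \sum_(i < d) c i *: b i.

Definition direct_sum2 S T U : Prop :=
  [/\ subspace T, subspace U,
      forall v, T v -> S v, forall v, U v -> S v
    & forall v, S v -> exists! p : V * V, [/\ T p.1, U p.2 & v = p.1 + p.2]].

(* Uniqueness of the decomposition is stated as uniqueness of that of 0. *)
Definition direct_sum_family (C : nat -> V -> Prop) : Prop :=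
  [/\ forall i, subspace (C i),
      forall v, exists (d : nat) (u : nat -> V),
        (forall i, C i (u i)) /\ v = \sum_(i < d) u i
    & forall (d : nat) (u : nat -> V), (forall i, C i (u i)) ->
        \sum_(i < d) u i = 0 -> forall i : 'I_d, u i = 0].

End Subspaces.

Section LieNotions.
Variables (R : comNzRingType) (V : lieAlgType R).
Implicit Types L : V -> Prop.

Definition lie_subalgebra L : Prop :=
  subspace L /\ forall x y, L x -> L y -> L (lie x y).

Definition lie_isomorphic L (g : lieAlgType R) : Prop :=
  exists phi : {linear g -> V},
    [/\ forall x y, phi (lie x y) = lie (phi x) (phi y),
        injective phi
      & forall v, L v <-> exists x, v = phi x].

Variable U : lmodType R.
Implicit Types M N : U -> Prop.

(* The action is constrained on [L] and [M] only, not on the ambient spaces. *)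
Definition lie_module L (act : V -> U -> U) M : Prop :=
  [/\ subspace M,
      forall x u, L x -> M u -> M (act x u),
      forall a x y u, L x -> L y -> M u ->
        act (a *: x + y) u = a *: act x u + act y u,
      forall a x u v, L x -> M u -> M v ->
        act x (a *: u + v) = a *: act x u + act x v
    & forall x y u, L x -> L y -> M u ->
        act (lie x y) u = act x (act y u) - act y (act x u)].

Definition lie_submodule L (act : V -> U -> U) M N : Prop :=
  [/\ subspace N, forall u, N u -> M u
    & forall x u, L x -> N u -> N (act x u)].

Definition irreducible L (act : V -> U -> U) M : Prop :=
  [/\ lie_module L act M, exists2 u, M u & u <> 0
    & forall N, lie_submodule L act M N ->
        (forall u, N u -> u = 0) \/ (forall u, M u -> N u)].

End LieNotions.

(* The Lie algebra gl_n(R) is ['M[R]_n] with the commutator bracket. *)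
Section GeneralLinear.
Variables (R : comNzRingType) (n : nat).
Implicit Types A B C : 'M[R]_n.

Definition gl_lie A B : 'M[R]_n := A *m B - B *m A.

Fact gl_lie_linearl B : linear (gl_lie^~ B).
Proof.
move=> a A1 A2; rewrite /gl_lie mulmxDl mulmxDr -scalemxAl -scalemxAr.
by rewrite scalerBr opprD addrACA.
Qed.

Fact gl_lie_linearr A : linear (gl_lie A).
Proof.
move=> a B1 B2; rewrite /gl_lie mulmxDl mulmxDr -scalemxAl -scalemxAr.
by rewrite scalerBr opprD addrACA.
Qed.

Fact gl_lie_alt A : gl_lie A A = 0.
Proof. exact: subrr. Qed.

Fact gl_lie_jacobi A B C :
  gl_lie A (gl_lie B C) + gl_lie B (gl_lie C A) + gl_lie C (gl_lie A B) = 0.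
Proof.
rewrite /gl_lie !mulmxBl !mulmxBr !mulmxA.
by apply/matrixP=> i j; rewrite !mxE; ring.
Qed.

HB.instance Definition _ := Lmodule_isLieAlgebra.Build R 'M[R]_n
  gl_lie_linearl gl_lie_linearr gl_lie_alt gl_lie_jacobi.

End GeneralLinear.

Record derivation (R : comNzRingType) (n : nat) := Derivation {
  der_fun :> {mpoly R[n]} -> {mpoly R[n]};
  der_linear : linear der_fun;
  der_leibniz : forall p q, der_fun (p * q) = der_fun p * q + p * der_fun q
}.

Section Derivations.
Variables (R : comNzRingType) (n : nat).
Local Notation A := {mpoly R[n]}.
Local Notation W := (derivation R n).
Implicit Types (D E F : W) (p q : A).

Lemma derP D E : (forall p, D p = E p) -> D = E.
Proof.
case: D E => [d dl dm] [e el em] /= de.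
have ed : d = e by apply: functional_extensionality.
by subst e; congr Derivation; apply: proof_irrelevance.
Qed.

HB.instance Definition _ D :=
  GRing.isLinear.Build R A A *:%R (der_fun D) (der_linear D).

Definition der_of_fun (f : {ffun 'I_n -> A}) p : A :=
  \sum_(i < n) f i * p^`M(i).

Fact der_of_linear f : linear (der_of_fun f).
Proof.
move=> a p q; rewrite /der_of_fun scaler_sumr -big_split /=.
by apply: eq_bigr => i _; rewrite linearP mulrDr scalerAr.
Qed.

Fact der_of_leibniz f p q :
  der_of_fun f (p * q) = der_of_fun f p * q + p * der_of_fun f q.
Proof.
rewrite /der_of_fun mulr_suml mulr_sumr -big_split /=.
by apply: eq_bigr => i _; rewrite mderivM; ring.
Qed.

Definition der_of f : W := Derivation (der_of_linear f) (der_of_leibniz f).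

Definition der_coef D : {ffun 'I_n -> A} := [ffun i => D 'X_i].

Lemma der1 D : D 1 = 0.
Proof.
by apply: (addrI (D 1)); rewrite addr0 -{3}[1]mul1r der_leibniz mulr1 mul1r.
Qed.

Lemma der_ofK : cancel der_of der_coef.
Proof.
move=> f; apply/ffunP=> i; rewrite ffunE /= /der_of_fun (bigD1 i) //=.
rewrite mderivX mnm1E eqxx scale1r.
have -> : (U_(i) - U_(i) = 0 :> 'X_{1..n})%MM.
  by apply/mnmP=> k; rewrite mnmBE subnn mnm0E.
rewrite mpolyX0 mulr1 big1 ?addr0 // => j ji.
by rewrite mderivX mnm1E eq_sym (negbTE ji) scale0r mulr0.
Qed.

Lemma der_coefK : cancel der_coef der_of.
Proof.
move=> D; set E := der_of _.
have EX i : E 'X_i = D 'X_i.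
  by have /ffunP/(_ i) := der_ofK (der_coef D); rewrite !ffunE.
move: E EX => E EX.
have EM p q : E p = D p -> E q = D q -> E (p * q) = D (p * q).
  by move=> ep eq; rewrite !der_leibniz ep eq.
have E1 : E 1 = D 1 by rewrite !der1.
apply: derP; elim/mpolyind => [|c m p _ _ IH]; first by rewrite !linear0.
rewrite !linearD !linearZ /= IH mpolyXE_id; congr (_ *: _ + _).
elim/big_ind: _ => // i _; elim: (m i) => // k IHk; rewrite exprS; exact: EM.
Qed.

HB.instance Definition _ := Choice.copy W (can_type der_coefK).

Definition der_zero : W.
Proof.
by exists (fun _ => 0) => [a p q|p q];
  rewrite ?(scaler0, mul0r, mulr0) addr0.
Defined.

Definition der_opp D : W.
Proof.
exists (fun p => - D p) => [a p q|p q].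
  by rewrite linearP opprD scalerN.
by rewrite der_leibniz; ring.
Defined.

Definition der_add D E : W.
Proof.
exists (fun p => D p + E p) => [a p q|p q].
  by rewrite !linearP scalerDr addrACA.
by rewrite !der_leibniz; ring.
Defined.

Definition der_scale (a : R) D : W.
Proof.
exists (fun p => a *: D p) => [b p q|p q].
  by rewrite linearP scalerDr !scalerA mulrC.
by rewrite der_leibniz scalerDr scalerAl scalerAr.
Defined.

Fact der_addA : associative der_add.
Proof. by move=> D E F; apply: derP => p /=; rewrite addrA. Qed.
Fact der_addC : commutative der_add.
Proof. by move=> D E; apply: derP => p /=; rewrite addrC. Qed.
Fact der_add0 : left_id der_zero der_add.
Proof. by move=> D; apply: derP => p /=; rewrite add0r. Qed.
Fact der_addN : left_inverse der_zero der_opp der_add.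
Proof. by move=> D; apply: derP => p /=; rewrite addNr. Qed.

HB.instance Definition _ :=
  GRing.isZmodule.Build W der_addA der_addC der_add0 der_addN.

Fact der_scaleA a b D : der_scale a (der_scale b D) = der_scale (a * b) D.
Proof. by apply: derP => p /=; rewrite scalerA. Qed.
Fact der_scale1 : left_id 1 der_scale.
Proof. by move=> D; apply: derP => p /=; rewrite scale1r. Qed.
Fact der_scaleDr : right_distributive der_scale +%R.
Proof. by move=> a D E; apply: derP => p /=; rewrite scalerDr. Qed.
Fact der_scaleDl D : {morph der_scale^~ D : a b / a + b}.
Proof. by move=> a b; apply: derP => p /=; rewrite scalerDl. Qed.

HB.instance Definition _ := GRing.Zmodule_isLmodule.Build R W
  der_scaleA der_scale1 der_scaleDr der_scaleDl.

Definition der_lie D E : W.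
Proof.
exists (fun p => D (E p) - E (D p)) => [a p q|p q].
  by rewrite !linearP /= scalerBr scalerN addrACA.
by rewrite !der_leibniz !linearD /= !der_leibniz; ring.
Defined.

Fact der_lie_linearl E : linear (der_lie^~ E).
Proof.
move=> a D1 D2; apply: derP => p /=.
by rewrite linearP /= scalerBr opprD addrACA.
Qed.

Fact der_lie_linearr D : linear (der_lie D).
Proof.
move=> a E1 E2; apply: derP => p /=.
by rewrite linearP /= scalerBr opprD addrACA.
Qed.

Fact der_lie_alt D : der_lie D D = 0.
Proof. by apply: derP => p /=; rewrite subrr. Qed.

Fact der_lie_jacobi D E F :
  der_lie D (der_lie E F) + der_lie E (der_lie F D) + der_lie F (der_lie D E)
  = 0.
Proof. by apply: derP => p /=; rewrite !linearB /=; ring. Qed.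

HB.instance Definition _ := Lmodule_isLieAlgebra.Build R W
  der_lie_linearl der_lie_linearr der_lie_alt der_lie_jacobi.

Definition der_mul (f : A) D : W.
Proof.
exists (fun p => f * D p) => [a p q|p q].
  by rewrite linearP mulrDr scalerAr.
by rewrite der_leibniz; ring.
Defined.

Definition euler : W := der_of [ffun i => 'X_i].

(* By [der_coefK] and [der_ofK], [D 'X_i] is the coefficient f_i of
   [D = \sum_i f_i d/dx_i]. *)
Definition divergence D : A := \sum_(i < n) (D 'X_i)^`M(i).

(* The homogeneous component of degree [j] of the standard grading; it is zero
   for [j < -1]. *)
Definition W_comp (j : int) D : Prop :=
  forall i, D 'X_i = 0 \/ exists2 d : nat, d%:Z = j + 1 & D 'X_i \is d.-homog.

Definition W_div0 (j : int) D : Prop := W_comp j D /\ divergence D = 0.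

Definition W_euler (j : int) D : Prop :=
  W_comp j D /\ exists f : A, D = der_mul f euler.

End Derivations.

(* Main.v *)
Require Import Defs.
From HB Require Import structures.
From mathcomp Require Import all_boot all_order all_algebra.
From mathcomp Require Import mpoly.
From mathcomp Require Import ring zify.
From Stdlib Require Import Classical.

(** Write [E] for the Euler derivation, [d_i] for the partial derivatives and
    [D_i] for the coefficients [D x_i] of a derivation [D].

    The structural part is a set of direct computations.  A derivation is
    determined by its values on the variables ([der_ext]), and [gl_der] sends
    a matrix [A] to the linear vector field [x_j |-> sum_i A_ij x_i].
    Divergence satisfies [div [D, F] = D (div F) - F (div D)]
    ([divergence_lie]), and [div D] is constant for [D] in [L], so [M_m] is
    stable under [L].  Elements of [L] commute with [E], so
    [[D, f E] = D(f) E], and [N_m] is stable.  For [f] homogeneous of degree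
    [m], [div (f E) = (n + m) f]; as [n + m] is invertible, the component of
    [D] in [N_m] has to be [(n + m)^-1 (div D) E], and this gives
    [W^[m] = M_m + N_m], a direct sum ([W_comp_split]).

    Irreducibility is proved without weight theory.  Fix a variable [x_k].
    The raising operators [ad (x_k d_b)], [b != k], strictly increase a bounded
    height, so every nonzero submodule contains a nonzero [D] annihilated by
    all of them ([exists_killed]).  Solving the resulting equations gives
    ([killed_form])
      [D = c x_k^m E + x_k^(m+1) sum_(i != k) e_i d_i].

    - In [N_m] this forces [D = c x_k^m E] with [c != 0].  Since
      [[x_a d_k, f E] = (x_a d_k f) E], the operators [x_a d_k] then produce
      [f E] for every monomial [f] of degree [m] ([dhomog_generated]).

    - In [M_m] the divergence of [D] is [(n + m) c x_k^m], so [c = 0]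
      ([killed_div0]).  Some [e_j] is nonzero, and the bracket of [x_j d_l]
      with [D] is [- e_j x_k^(m+1) d_l], so the submodule contains all the
      [x_k^(m+1) d_l], [l != k].  Up to a nonzero scalar these are the fields
      [ham k l f = (d_l f) d_k - (d_k f) d_l] with [f = x_k^(m+2)], and
      [[x_a d_k, ham k l f] = ham k l (x_a d_k f)] for [a != k], so the same
      generation argument gives all [ham k l f].  These fields span [M_m], by a
      homotopy formula as in the Poincare lemma ([div0_sum_ham]). *)

Set Implicit Arguments.
Unset Strict Implicit.
Unset Printing Implicit Defensive.

Import Order.TTheory GRing.Theory Num.Theory.
Local Open Scope ring_scope.

(** * Subspaces *)

Section Subspaces.
Variables (R : comNzRingType) (V : lmodType R) (S : V -> Prop).
Hypothesis Ssub : subspace S.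

Lemma subspaceZ a v : S v -> S (a *: v).
Proof.
by move=> Sv; rewrite -[_ *: _]addr0; apply: Ssub.2 => //; apply: Ssub.1.
Qed.

Lemma subspace_sum (I : finType) (F : I -> V) :
  (forall i, S (F i)) -> S (\sum_i F i).
Proof.
move=> SF; elim/big_ind: _ => //; first exact: Ssub.1.
by move=> u v Su Sv; rewrite -[u]scale1r; apply: Ssub.2.
Qed.

Lemma subspace_preim (U : lmodType R) (f : U -> V) :
  linear f -> subspace (fun u => S (f u)).
Proof.
move=> flin; split=> [|a u v Su Sv]; last by rewrite flin; apply: Ssub.2.
have -> : f 0 = 0.
  by have := flin (-1) 0 0; rewrite scaler0 addr0 scaleN1r addNr.
exact: Ssub.1.
Qed.

End Subspaces.

(** * Homogeneous polynomials *)

Section Polynomials.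
Variables (R : comNzRingType) (n : nat).
Implicit Types (p q : {mpoly R[n]}) (m : 'X_{1..n}) (i j k : 'I_n).

Lemma mcoeffXM i p m :
  ('X_i * p)@_m = if (0 < m i)%N then p@_(m - U_(i)) else 0.
Proof.
case: ifPn => [mi_gt0 | mi0].
  rewrite mulrC -[in LHS](@submK _ U_(i) m) ?lep1mP -?lt0n //.
  by rewrite addmC mcoeffMX.
rewrite mcoeffM big1 // => -[k1 k2] /= /eqP m_eq.
rewrite mcoeffX; case: eqP => [k1E | _]; last by rewrite mul0r.
move: mi0; have /(congr1 (fun u : 'X_{1..n} => u i)) := m_eq.
by rewrite mnmDE -k1E mnm1E eqxx => ->.
Qed.

Lemma mcoeffX_mderiv i p m : ('X_i * p^`M(i))@_m = p@_m *+ m i.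
Proof.
rewrite mcoeffXM; case: ifPn => [mi_gt0 | ]; last first.
  by rewrite -eqn0Ngt => /eqP->.
by rewrite mcoeff_deriv submK ?lep1mP -?lt0n // mnmBE mnm1E eqxx subn1 prednK.
Qed.

Lemma mderivXU i j : ('X_i : {mpoly R[n]})^`M(j) = (i == j)%:R.
Proof.
rewrite mderivX mnm1E; case: eqP => [-> | _]; last by rewrite scale0r.
rewrite scale1r; suff -> : (U_(j) - U_(j) = 0 :> 'X_{1..n})%MM.
  by rewrite mpolyX0.
by apply/mnmP=> k; rewrite mnmBE subnn mnm0E.
Qed.

Lemma dhomog_coefP d p :
  reflect (forall m, mdeg m != d -> p@_m = 0) (p \is d.-homog).
Proof.
apply: (iffP idP) => [hp m | hp]; first exact: dhomog_nemf_coeff.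
apply/dhomogP=> m /=; rewrite mcoeff_msupp.
by case: (eqVneq (mdeg m) d) => // /hp->; rewrite eqxx.
Qed.

Lemma dhomog_mderiv d i p : p \is d.+1.-homog -> p^`M(i) \is d.-homog.
Proof.
move/dhomog_coefP=> hp; apply/dhomog_coefP=> m md.
by rewrite mcoeff_deriv hp ?mul0rn // mdegD mdeg1 addn1 eqSS.
Qed.

Lemma dhomog0_mderiv i p : p \is 0.-homog -> p^`M(i) = 0.
Proof.
move/dhomog_coefP=> hp; apply/mpolyP=> m.
by rewrite mcoeff_deriv mcoeff0 hp ?mul0rn // mdegD mdeg1 addn1.
Qed.

Lemma dhomogXU i : ('X_i : {mpoly R[n]}) \is 1.-homog.
Proof. by rewrite dhomogX /= mdeg1. Qed.

Lemma dhomogXM d i p : p \is d.-homog -> 'X_i * p \is d.+1.-homog.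
Proof. by move=> hp; rewrite -add1n; apply: dhomogM => //; apply: dhomogXU. Qed.

Lemma dhomogXMK d i p : 'X_i * p \is d.+1.-homog -> p \is d.-homog.
Proof.
move/dhomog_coefP=> hp; apply/dhomog_coefP=> m md.
by rewrite -(mcoeffMX _ U_(i)) mulrC hp // mdegD mdeg1 add1n eqSS.
Qed.

Lemma dhomogXn d i : ('X_i : {mpoly R[n]}) ^+ d \is d.-homog.
Proof. by rewrite -{2}[d]mul1n; apply: dhomogMn; apply: dhomogXU. Qed.

Lemma euler_dhomog d p : p \is d.-homog -> euler R n p = p *+ d.
Proof.
move/dhomog_coefP=> hp; apply/mpolyP=> m; rewrite mcoeffMn.
rewrite /= /der_of_fun raddf_sum /=.
under eq_bigr => i _ do rewrite ffunE mcoeffX_mderiv.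
rewrite sumrMnr -mdegE.
by case: (eqVneq (mdeg m) d) => [-> // | /hp ->]; rewrite !mul0rn.
Qed.

Lemma mderivXn i j d :
  (('X_i : {mpoly R[n]}) ^+ d.+1)^`M(j) = (i == j)%:R * 'X_i ^+ d *+ d.+1.
Proof.
elim: d => [|d IH]; first by rewrite expr1 expr0 mulr1 mderivXU.
rewrite exprS mderivM IH mderivXU; case: eqP => _; last first.
  by rewrite !mul0r !mul0rn mulr0 addr0.
by rewrite !mul1r mulrnAr -exprS [in RHS]mulrS.
Qed.

End Polynomials.

Section CharacteristicZero.
Variables (K : fieldType) (charK : [pchar K] =i pred0) (n : nat).
Implicit Types (p q : {mpoly K[n]}) (m : 'X_{1..n}) (i j k : 'I_n).

Lemma natS_neq0 d : (d.+1%:R : K) != 0.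
Proof. by move/pcharf0P: charK => ->. Qed.

Lemma nat_gt0_neq0 d : (0 < d)%N -> (d%:R : K) != 0.
Proof. by case: d => // d _; apply: natS_neq0. Qed.

Lemma XM_eq0 i p : 'X_i * p = 0 -> p = 0.
Proof.
move=> Xp0; apply/mpolyP=> m.
by rewrite -(mcoeffMX p U_(i)) mulrC Xp0 !mcoeff0.
Qed.

Lemma mnm_one_variable k m :
  (forall i, i != k -> m i = 0%N) -> m = (U_(k) *+ mdeg m)%MM.
Proof.
move=> m0; apply/mnmP=> i; rewrite mulmnE mnm1E.
have -> : mdeg m = m k by rewrite mdegE (bigD1 k) //= big1 ?addn0.
by case: eqP => [-> | /eqP ki]; rewrite ?mul1n // m0 // eq_sym.
Qed.

(** In characteristic zero the vanishing of a partial derivative kills every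
    monomial in which that variable occurs. *)
Lemma dhomog_one_variable d k p : p \is d.-homog ->
  (forall i, i != k -> p^`M(i) = 0) -> p = p@_(U_(k) *+ d) *: 'X_k ^+ d.
Proof.
move/dhomog_coefP=> hp p0; apply/mpolyP=> m.
rewrite mcoeffZ mcoeffXn; case: eqP => [<- | /eqP mN]; first by rewrite mulr1.
rewrite mulr0; case: (eqVneq (mdeg m) d) => [md | /hp //].
have [i /andP[ik mi] | no] := @pickP _ (fun i => (i != k) && (0 < m i)%N).
  have := p0 _ ik => /(congr1 (mcoeff (m - U_(i)))).
  rewrite mcoeff_deriv mcoeff0 submK ?lep1mP -?lt0n // -mulr_natr => /eqP.
  by rewrite mulf_eq0 (negbTE (natS_neq0 _)) orbF => /eqP.
case/eqP: mN; rewrite -md -mnm_one_variable // => i ik.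
by apply/eqP; move: (no i); rewrite ik /= lt0n => /negbFE.
Qed.

(** The operators [x_a d_k] lower the exponent of [x_k] by one and raise that of
    [x_a] by one, with the nonzero factor that [d_k] brings down; starting from
    [x_k^d] they reach every monomial of degree [d]. *)
Lemma dhomog_generated d k (P : {mpoly K[n]} -> Prop) :
    subspace P -> P ('X_k ^+ d) ->
    (forall a p, a != k -> p \is d.-homog -> P p -> P ('X_a * p^`M(k))) ->
  forall p, p \is d.-homog -> P p.
Proof.
move=> [P0 Plin] Ptop Pstep.
have PZ c p : P p -> P (c *: p).
  by move=> Pp; rewrite -[_ *: _]addr0; apply: Plin.
have Pmon : forall s m, mdeg m = d -> (d <= m k + s)%N -> P 'X_[m].
  (* [s] bounds the degree of ['X_[m]] in the variables other than [x_k]. *)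
  elim=> [|s IHs] m md ms.
    suff -> : m = (U_(k) *+ d)%MM by rewrite -mpolyXn.
    rewrite -md; apply: mnm_one_variable => i ik.
    by move: ms; rewrite -md mdegE (bigD1 k) //= (bigD1 i) //=; lia.
  have [i /andP[ik mi] | no] := @pickP _ (fun i => (i != k) && (0 < m i)%N).
    (* [x_i d_k] turns ['X_[m']] into a nonzero multiple of ['X_[m]]. *)
    pose m' := (m - U_(i) + U_(k))%MM.
    have m'd : mdeg m' = d.
      rewrite -md -[in RHS](@submK _ U_(i) m) ?lep1mP -?lt0n //.
      by rewrite !mdegD !mdeg1.
    have m'k : m' k = (m k).+1.
      by rewrite mnmDE mnmBE !mnm1E eqxx (negbTE ik) subn0 addn1.
    have -> : 'X_[m] = (m k).+1%:R^-1 *: ('X_i * ('X_[m'])^`M(k))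
        :> {mpoly K[n]}.
      rewrite mderivX m'k -scalerAr scalerA mulVf ?natS_neq0 // scale1r.
      rewrite -mpolyXD; congr 'X_[_]; rewrite addmK addmC submK //.
      by rewrite lep1mP -lt0n.
    apply: PZ; apply: Pstep => //; first by rewrite dhomogX /= m'd.
    by apply: IHs => //; rewrite m'k; lia.
  suff -> : m = (U_(k) *+ d)%MM by rewrite -mpolyXn.
  rewrite -md; apply: mnm_one_variable => i ik.
  by apply/eqP; move: (no i); rewrite ik /= lt0n => /negbFE.
move=> p /dhomogP hp; rewrite [p]mpolyE.
rewrite big_seq; elim/big_ind: _ => // [p1 p2 P1 P2 | m mp].
  by rewrite -[p1]scale1r; apply: Plin.
by apply: PZ; apply: (Pmon d) (hp _ mp) _; apply: leq_addl.
Qed.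

End CharacteristicZero.

(** * The grading, the divergence and the Euler derivation *)

Section GradedDerivations.
Variables (R : comNzRingType) (n : nat).
Local Notation W := (derivation R n).
Local Notation E := (euler R n).
Implicit Types (p q f : {mpoly R[n]}) (i j k a b : 'I_n) (D F : W).

Lemma der_ext D F : (forall i, D 'X_i = F 'X_i) -> D = F.
Proof.
move=> DF; rewrite -[D]der_coefK -[F]der_coefK; congr der_of.
by apply/ffunP=> i; rewrite !ffunE.
Qed.

Lemma derE D p : D p = \sum_(i < n) D 'X_i * p^`M(i).
Proof.
rewrite -{1}[D]der_coefK /= /der_of_fun.
by apply: eq_bigr => i _; rewrite ffunE.
Qed.

Lemma der_zeroE p : (0 : W) p = 0. Proof. by []. Qed.
Lemma der_addE D F p : (D + F) p = D p + F p. Proof. by []. Qed.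
Lemma der_scaleE (c : R) D p : (c *: D) p = c *: D p. Proof. by []. Qed.
Lemma der_lieE D F p : (lie D F) p = D (F p) - F (D p). Proof. by []. Qed.
Lemma der_mulE f D p : (der_mul f D) p = f * D p. Proof. by []. Qed.

Lemma der_ofX (g : {ffun 'I_n -> {mpoly R[n]}}) i : der_of g 'X_i = g i.
Proof. by have /ffunP/(_ i) := der_ofK g; rewrite ffunE. Qed.

Lemma eulerX i : E 'X_i = 'X_i.
Proof. by rewrite der_ofX ffunE. Qed.

Lemma der_sumE (I : finType) (F : I -> W) p :
  (\sum_i F i) p = \sum_i F i p.
Proof. by elim/big_rec2: _ => // i q D _ <-. Qed.

Lemma W_compP d D :
  W_comp (d%:Z - 1) D <-> forall i, D 'X_i \is d.-homog.
Proof.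
split=> hD i; last by right; exists d; rewrite ?subrK.
case: (hD i) => [-> | [e]]; first exact: dhomog0.
by rewrite subrK => -[->].
Qed.

Lemma W_comp0P D : W_comp 0 D <-> forall i, D 'X_i \is 1.-homog.
Proof. exact: (W_compP 1). Qed.

Lemma W_comp_subspace d : subspace (@W_comp R n (d%:Z - 1)).
Proof.
split=> [|c D F]; first by apply/W_compP=> i; apply: dhomog0.
move=> /W_compP hD /W_compP hF; apply/W_compP => i.
by apply: dhomogD => //; apply: dhomogZ.
Qed.

Lemma der_dhomog d e D p : (forall i, D 'X_i \is d.-homog) ->
  p \is e.+1.-homog -> D p \is (d + e).-homog.
Proof.
move=> hD hp; rewrite derE; apply: rpred_sum => i _.
by apply: dhomogM => //; apply: dhomog_mderiv.
Qed.

Lemma der_const D p : p \is 0.-homog -> D p = 0.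
Proof.
by move=> hp; rewrite derE big1 // => i _; rewrite dhomog0_mderiv ?mulr0.
Qed.

Lemma der_dhomog1 d D p : (forall i, D 'X_i \is 1.-homog) ->
  p \is d.-homog -> D p \is d.-homog.
Proof.
move=> hD; case: d => [|d] hp; last exact: (@der_dhomog 1).
by rewrite der_const ?dhomog0.
Qed.

Lemma W_comp_lie d D F :
  W_comp 0 D -> W_comp (d%:Z - 1) F -> W_comp (d%:Z - 1) (lie D F).
Proof.
move=> /W_comp0P hD /W_compP hF; apply/W_compP => i; rewrite der_lieE.
apply: dhomogD; first exact: der_dhomog1.
by rewrite dhomogN -[d]addn0; apply: der_dhomog.
Qed.

(** Stability is all there is to check: compatibility with brackets is the
    Jacobi identity. *)
Lemma lie_module_stable (L M : W -> Prop) : subspace M ->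
  (forall D F, L D -> M F -> M (lie D F)) -> lie_module L lie M.
Proof.
move=> Msub Mst; split=> //.
- by move=> c D1 D2 F _ _ _; apply: (lie_linearl F).
- by move=> c D F1 F2 _ _ _; apply: (lie_linearr D).
move=> D1 D2 F _ _ _; apply: derP => p.
rewrite !(der_lieE, der_addE) /= !linearB /=.
by ring.
Qed.

Lemma divergence_linear : linear (@divergence R n).
Proof.
move=> c D F; rewrite /divergence scaler_sumr -big_split /=.
by apply: eq_bigr => i _; rewrite linearP.
Qed.

Lemma divergence0 : divergence (0 : W) = 0.
Proof. by rewrite /divergence big1 // => i _; rewrite mderiv0. Qed.

Lemma divergence_mul f D : divergence (der_mul f D) = f * divergence D + D f.
Proof.
rewrite /divergence derE mulr_sumr -big_split /=.
by apply: eq_bigr => i _; rewrite mderivM; ring.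
Qed.

Lemma divergence_euler_mul d f : f \is d.-homog ->
  divergence (der_mul f E) = f *+ (n + d).
Proof.
move=> hf; rewrite divergence_mul (euler_dhomog hf) mulrnDr; congr (_ + _).
rewrite /divergence; under eq_bigr => i _ do rewrite eulerX mderivXU eqxx.
by rewrite sumr_const card_ord mulr_natr.
Qed.

Lemma mderiv_der i D p :
  (D p)^`M(i) = \sum_(j < n) (D 'X_j)^`M(i) * p^`M(j) + D (p^`M(i)).
Proof.
rewrite [D p]derE [D (_ ^`M(_))]derE linear_sum -big_split /=.
by apply: eq_bigr => j _; rewrite mderivM [p^`M(i)^`M(j)]mderiv_comm.
Qed.

(** The second-order terms assemble into [D (div F) - F (div D)]; the remaining
    terms [sum_(i,j) (d_i D_j) (d_j F_i)] are symmetric in [D] and [F] and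
    cancel. *)
Lemma divergence_lie D F :
  divergence (lie D F) = D (divergence F) - F (divergence D).
Proof.
rewrite /divergence.
under eq_bigr => i _.
  rewrite der_lieE mderivB (mderiv_der i D (F _)) (mderiv_der i F (D _)).
  over.
rewrite !linear_sum /=.
rewrite sumrB !big_split /= [X in _ - (X + _)]exchange_big /=.
rewrite opprD addrACA -[RHS]add0r; congr (_ + _);
  last by rewrite sumrN.
rewrite -sumrB big1 // => i _; rewrite -sumrB big1 // => j _.
by rewrite mulrC subrr.
Qed.

Lemma divergence_dhomog d D :
  (forall i, D 'X_i \is d.+1.-homog) -> divergence D \is d.-homog.
Proof.
by move=> hD; apply: rpred_sum => i _; apply: dhomog_mderiv.
Qed.

(** [D] in [L] commutes with [E], because [E] acts as the identity on the linear
    forms [D x_i]. *)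
Lemma lie_euler_mul D f : W_comp 0 D ->
  lie D (der_mul f E) = der_mul (D f) E.
Proof.
move/W_comp0P=> hD; apply: der_ext => i.
rewrite der_lieE !der_mulE eulerX der_leibniz.
by rewrite (euler_dhomog (hD i)) mulr1n addrK.
Qed.

Lemma der_mul_euler_linear c f g :
  der_mul (c *: f + g) E = c *: der_mul f E + der_mul g E.
Proof.
by apply: der_ext => i; rewrite der_addE der_scaleE !der_mulE mulrDl scalerAl.
Qed.

(** The homogeneity of [f] is not part of the definition of [N_m]; it is forced
    by that of [x_i f], for which one variable has to exist. *)
Lemma W_eulerP d D : (0 < n)%N ->
  W_euler (d.+1%:Z - 1) D <->
  exists2 f, f \is d.-homog & D = der_mul f E.
Proof.
move=> n_gt0; split=> [[/W_compP hD [f Df]] | [f hf ->]].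
  exists f => //; have := hD (Ordinal n_gt0).
  by rewrite Df der_mulE eulerX mulrC => /dhomogXMK.
split; last by exists f.
by apply/W_compP=> i; rewrite der_mulE eulerX mulrC; apply: dhomogXM.
Qed.

Lemma W_div0_submodule d :
  lie_submodule (W_comp 0) lie (@W_comp R n (d%:Z - 1)) (W_div0 (d%:Z - 1)).
Proof.
have [W0 Wlin] := W_comp_subspace d.
split=> [||D F LD [hF dF]]; last first.
- split; first exact: W_comp_lie.
  rewrite divergence_lie dF linear0 sub0r der_const ?oppr0 //.
  by apply: divergence_dhomog; apply/W_comp0P.
- by move=> D [].
split=> [|c D F [hD dD] [hF dF]]; first by split; rewrite ?divergence0.
split; first exact: Wlin.
by rewrite divergence_linear dD dF scaler0 addr0.
Qed.

Lemma W_euler_submodule d :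
  lie_submodule (W_comp 0) lie (@W_comp R n (d%:Z - 1)) (W_euler (d%:Z - 1)).
Proof.
have [W0 Wlin] := W_comp_subspace d.
split=> [||D F LD [hF [f Ff]]]; last first.
- split; first exact: W_comp_lie.
  by exists (D f); rewrite Ff lie_euler_mul.
- by move=> D [].
split=> [|c D F [hD [f Df]] [hF [g Fg]]].
  by split=> //; exists 0; apply: der_ext => i; rewrite der_mulE mul0r.
split; first exact: Wlin.
by exists (c *: f + g); rewrite der_mul_euler_linear Df Fg.
Qed.

Lemma msize_dhomog d p : p \is d.-homog -> (msize p <= d.+1)%N.
Proof.
move/dhomogP=> hp; rewrite mmeasureE; apply/bigmax_leqP_seq => m mp _.
by rewrite hp.
Qed.

Lemma W_comp_finite_dimensional d :
  finite_dimensional (@W_comp R n (d%:Z - 1)).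
Proof.
pose I : finType := ('X_{1..n < d.+1} * 'I_n)%type.
(* Pairs whose monomial has the wrong degree are sent to the zero derivation. *)
pose mono (x : I) : W := der_of
  [ffun i => if (mdeg x.1 == d) && (i == x.2) then 'X_[x.1] else 0].
exists #|I|, (fun i : 'I_#|I| => mono (enum_val i)).
split=> [i | D /W_compP hD].
  apply/W_compP=> j; rewrite der_ofX ffunE.
  by case: ifP => [/andP[md _] | _]; rewrite ?dhomog0 ?dhomogX.
exists (fun i : 'I_#|I| => (D 'X_((enum_val i).2))@_((enum_val i).1)).
rewrite -(big_enum_val (A := I) (fun x : I => (D 'X_x.2)@_x.1 *: mono x)) /=.
apply: der_ext => i; rewrite der_sumE.
rewrite {1}(mpolywE (msize_dhomog (hD i))).
under [RHS]eq_bigr => x _ do rewrite der_scaleE der_ofX ffunE.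
rewrite -(pair_big xpredT xpredT (fun (m : 'X_{1..n < d.+1}) j =>
  (D 'X_j)@_m *: if (mdeg m == d) && (i == j) then 'X_[m] else 0)) /=.
apply: eq_bigr => m _; rewrite (bigD1 i) //= big1 => [|j ji].
  rewrite addr0 eqxx andbT.
  by case: eqP => // /eqP md; rewrite (dhomog_nemf_coeff (hD i) md) !scale0r.
by rewrite [i == j]eq_sym (negbTE ji) andbF scaler0.
Qed.

Lemma W_comp_direct_sum :
  direct_sum_family (fun d : nat => @W_comp R n (d%:Z - 1)).
Proof.
split=> [d | D | N u hu u0 i]; first exact: W_comp_subspace.
  pose N := \max_i msize (D 'X_i).
  pose u d : W := der_of [ffun i => pihomog mdeg d (D 'X_i)].
  exists N, u; split=> [d | ].
    by apply/W_compP=> i; rewrite der_ofX ffunE; apply: pihomogP.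
  apply: der_ext => i; rewrite der_sumE.
  under eq_bigr => d _ do rewrite der_ofX ffunE.
  by apply: pihomog_partitionE; apply: leq_bigmax.
apply: der_ext => j; rewrite der_zeroE.
have hj d : u d 'X_j \is d.-homog by have /W_compP/(_ j) := hu d.
have := der_sumE (fun d : 'I_N => u d) 'X_j.
rewrite u0 der_zeroE => /(congr1 (pihomog mdeg i)).
rewrite pihomog0 linear_sum (bigD1 i) //= big1 => [|d di].
  by rewrite addr0 pihomog_dE.
by rewrite (@pihomog_ne0 _ _ _ d) // hj.
Qed.

(** Placing the coefficients of [D x_j] in column [j], rather than in row [j],
    makes this a morphism and not an anti-morphism of Lie algebras. *)
Definition gl_der (A : 'M[R]_n) : W :=
  der_of [ffun j => \sum_(i < n) A i j *: 'X_i].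

Lemma gl_derX A j : gl_der A 'X_j = \sum_(i < n) A i j *: 'X_i.
Proof. by rewrite der_ofX ffunE. Qed.

Lemma gl_der_linear : linear gl_der.
Proof.
move=> c A B; apply: der_ext => j.
rewrite der_addE der_scaleE !gl_derX scaler_sumr -big_split /=.
by apply: eq_bigr => i _; rewrite !mxE scalerDl scalerA.
Qed.

HB.instance Definition _ :=
  GRing.isLinear.Build R 'M[R]_n W *:%R gl_der gl_der_linear.

Lemma gl_der_comp A B j :
  gl_der A (gl_der B 'X_j) = \sum_(i < n) (A *m B) i j *: 'X_i.
Proof.
transitivity (\sum_(k < n) B k j *: gl_der A 'X_k).
  by rewrite gl_derX linear_sum; apply: eq_bigr => k _; rewrite linearZ.
under eq_bigr => k _ do rewrite gl_derX scaler_sumr.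
rewrite exchange_big; apply: eq_bigr => i _ /=.
by rewrite mxE scaler_suml; apply: eq_bigr => k _; rewrite scalerA mulrC.
Qed.

Lemma gl_der_lie A B : gl_der (lie A B) = lie (gl_der A) (gl_der B).
Proof.
apply: der_ext => j; rewrite der_lieE !gl_der_comp gl_derX -sumrB.
by apply: eq_bigr => i _; rewrite !mxE scalerBl.
Qed.

Lemma gl_der_coef A i j : (gl_der A 'X_j)@_(U_(i)) = A i j.
Proof.
rewrite gl_derX linear_sum (bigD1 i) //= mcoeffZ mcoeffXU eqxx mulr1.
by rewrite big1 ?addr0 // => k ki; rewrite mcoeffZ mcoeffXU (negbTE ki) mulr0.
Qed.

Lemma W_comp0_gl : lie_isomorphic (@W_comp R n 0) 'M[R]_n.
Proof.
exists gl_der; split=> [A B | A B AB | D]; first exact: gl_der_lie.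
  by apply/matrixP=> i j; rewrite -!gl_der_coef AB.
split=> [/W_comp0P hD | [A ->]]; last first.
  apply/W_comp0P=> j; rewrite gl_derX; apply: rpred_sum => i _.
  by apply: dhomogZ; apply: dhomogXU.
exists (\matrix_(i, j) (D 'X_j)@_(U_(i))).
apply: der_ext => j; apply/mpolyP=> m.
have [/mdeg1P[i /eqP->] | md] := boolP (mdeg m == 1%N).
  by rewrite gl_der_coef mxE.
rewrite (dhomog_nemf_coeff (hD j) md) gl_derX linear_sum big1 //= => i _.
rewrite mcoeffZ mcoeffX; case: eqP => [mE | _]; last by rewrite mulr0.
by move: md; rewrite -mE /= mdeg1.
Qed.


End GradedDerivations.

(** * Raising operators and Hamiltonian fields *)

Section RaisingOperators.
Variables (R : comNzRingType) (n : nat).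
Local Notation W := (derivation R n).
Implicit Types (p q f : {mpoly R[n]}) (i j k a b l : 'I_n) (D F : W).

Definition partial b : W := Derivation (mderiv_is_linear b) (mderivM b).

(** The elementary field [x_a d_b], the image of a matrix unit of [gl_n]. *)
Definition gl_unit a b : W := der_mul 'X_a (partial b).

Lemma partialE b p : partial b p = p^`M(b). Proof. by []. Qed.

Lemma partialX b i : partial b 'X_i = (i == b)%:R.
Proof. exact: mderivXU. Qed.

Lemma gl_unitE a b p : gl_unit a b p = 'X_a * p^`M(b). Proof. by []. Qed.

Lemma gl_unit_W_comp a b : W_comp 0 (gl_unit a b).
Proof.
apply/W_comp0P=> i; rewrite gl_unitE mderivXU; apply: dhomogXM.
by case: (i == b); [apply: dhomog1 | apply: dhomog0].
Qed.

Lemma lie_gl_unitX a b D i :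
  lie (gl_unit a b) D 'X_i = 'X_a * (D 'X_i)^`M(b) - (i == b)%:R * D 'X_a.
Proof.
rewrite der_lieE !gl_unitE mderivXU.
by case: (i == b); rewrite ?mulr1 ?mul1r // mulr0 mul0r linear0.
Qed.

(** The monomial field [x^m d_i] has height [m_k + 1] if [i != k] and [m_k] if
    [i = k]: this is its weight for [x_k d_k], shifted by one so as to be a
    natural number.  The predicate says that only heights at least [w] occur
    in [D]. *)
Definition height_ge k w D :=
  forall i (m : 'X_{1..n}), (m k + (i != k) < w)%N -> (D 'X_i)@_m = 0.

Lemma height_raise k b w D : b != k ->
  height_ge k w D -> height_ge k w.+1 (lie (gl_unit k b) D).
Proof.
move=> bk hD i m hm; rewrite lie_gl_unitX mcoeffB mcoeffXM.
have -> : ((i == b)%:R * D 'X_k)@_m = 0.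
  case: (i =P b) hm => [-> | _] hm; last by rewrite mul0r mcoeff0.
  by rewrite mul1r hD // eqxx; move: hm; rewrite bk; lia.
rewrite subr0; case: ifP => // mk; rewrite mcoeff_deriv hD ?mul0rn //.
by rewrite mnmDE mnmBE !mnm1E eqxx (negbTE bk); lia.
Qed.

(** A raising operator that does not annihilate the current element replaces it
    by a nonzero one of greater height; heights are at most [d + 1] in degree
    [d], so this stops. *)
Lemma exists_killed k d (N : W -> Prop) D :
    (forall F, N F -> forall i, F 'X_i \is d.-homog) ->
    (forall b F, N F -> N (lie (gl_unit k b) F)) ->
    N D -> D <> 0 ->
  exists F, [/\ N F, F <> 0 & forall b, b != k -> lie (gl_unit k b) F = 0].
Proof.
move=> Nhom Nst ND D0; have: height_ge k 0 D by [].
(* Induction on the gap [s] between the height [w] and the bound [d + 2]. *)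
have [s] : exists s, (d.+2 <= 0 + s)%N by exists d.+2.
elim: s (0%N) D ND D0 => [|s IHs].
  move=> w D ND D0; rewrite addn0 => dw hD; case: D0; apply: der_ext => i.
  apply/mpolyP=> m; rewrite mcoeff0.
  case: (eqVneq (mdeg m) d) => [md | md]; last first.
    exact: dhomog_nemf_coeff (Nhom _ ND i) md.
  apply: hD; apply: leq_trans dw; rewrite ltnS -addn1 leq_add ?leq_b1 //.
  by rewrite -md mdegE (bigD1 k) //= leq_addr.
move=> w D ND D0 ws hD.
case: (classic (forall b, b != k -> lie (gl_unit k b) D = 0)) => [kill | ].
  by exists D.
move/not_all_ex_not=> [b nb]; have [bk bD] := imply_to_and _ _ nb.
apply: (IHs w.+1 _ (Nst b _ ND) bD); first by rewrite addSnnS.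
exact: height_raise.
Qed.

(** The Hamiltonian field of [f] in the [(x_k, x_l)]-plane, divergence-free
    because second derivatives commute. *)
Definition ham k l f : W :=
  der_mul (f^`M(l)) (partial k) - der_mul (f^`M(k)) (partial l).

Lemma hamX k l f i :
  ham k l f 'X_i = f^`M(l) * (i == k)%:R - f^`M(k) * (i == l)%:R.
Proof. by rewrite -!partialX. Qed.

Lemma ham_linear k l : linear (ham k l).
Proof.
move=> c p q; apply: der_ext => i; rewrite [LHS]hamX.
rewrite der_addE der_scaleE !hamX !linearP /=.
by rewrite -!mul_mpolyC; ring.
Qed.

(** The bivector [d_k /\ d_l] is annihilated by [x_a d_k] when [a] is
    neither [k] nor [l]; for [a = l] the correction is a multiple of
    [d_k /\ d_k = 0]. *)
Lemma lie_gl_unit_ham a k l f : a != k -> k != l ->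
  lie (gl_unit a k) (ham k l f) = ham k l ('X_a * f^`M(k)).
Proof.
move=> ak kl; apply: der_ext => i; rewrite lie_gl_unitX !hamX.
rewrite !mderivM !mderivXU (negbTE ak) [f^`M(k)^`M(l)]mderiv_comm.
have nat_mderiv (c : bool) : (c%:R : {mpoly R[n]})^`M(k) = 0.
  by case: c; [apply: dhomog0_mderiv; apply: dhomog1 | apply: linear0].
rewrite mderivB !mderivM !nat_mderiv.
by case: (eqVneq i k) => [-> | _]; rewrite ?(negbTE kl) //=; ring.
Qed.

Lemma ham_pure k l d : k != l ->
  ham k l ('X_k ^+ d.+1) = - (d.+1%:R *: der_mul ('X_k ^+ d) (partial l)).
Proof.
move=> kl; apply: der_ext => i; rewrite hamX.
transitivity (- (d.+1%:R *: ('X_k ^+ d * (i == l)%:R)) : {mpoly R[n]}).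
  rewrite !mderivXn eqxx (negbTE kl) scaler_nat.
  by rewrite !mul0r mul0rn mul0r sub0r mul1r mulrnAl.
by rewrite -partialX.
Qed.

Lemma sum_delta (F : 'I_n -> {mpoly R[n]}) k :
  \sum_(i < n) (k == i)%:R * F i = F k.
Proof.
rewrite (bigD1 k) //= eqxx mul1r big1 ?addr0 // => i.
by rewrite eq_sym => /negbTE->; rewrite mul0r.
Qed.

(** The contraction [D |-> (x_l D_k - x_k D_l)_(k,l)] with the Euler field is a
    homotopy for the divergence complex: expanding the derivative gives
    [n D_k + E(D_k) - D_k - x_k div D]. *)
Lemma div0_homotopy d D k : (forall i, D 'X_i \is d.-homog) ->
  divergence D = 0 ->
  \sum_(l < n) ('X_l * D 'X_k - 'X_k * D 'X_l)^`M(l)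
    = D 'X_k *+ (n + d) - D 'X_k.
Proof.
move=> hD dD.
have step l : ('X_l * D 'X_k - 'X_k * D 'X_l)^`M(l) =
    (D 'X_k + 'X_l * (D 'X_k)^`M(l)) -
    ((k == l)%:R * D 'X_l + 'X_k * (D 'X_l)^`M(l)).
  by rewrite mderivB !mderivM !mderivXU eqxx mul1r.
under eq_bigr => l _ do rewrite step.
rewrite sumrB !big_split /= sumr_const card_ord -mulr_sumr.
rewrite [\sum_(i < n) (D 'X_i)^`M(i)]dD mulr0 addr0.
rewrite sum_delta mulrnDr -(euler_dhomog (hD k)); congr (_ + _ - _).
by rewrite [RHS]derE; apply: eq_bigr => l _; rewrite eulerX.
Qed.

(** Hence the Hamiltonian fields span the divergence-free ones.  The factor 2
    comes from summing over all ordered pairs, the bivector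
    [x_l D_k - x_k D_l] being antisymmetric. *)
Lemma div0_sum_ham d D : (forall i, D 'X_i \is d.-homog) -> divergence D = 0 ->
  \sum_(k < n) \sum_(l < n) ham k l ('X_l * D 'X_k - 'X_k * D 'X_l)
    = ((n + d)%:R - 1) *: D *+ 2.
Proof.
move=> hD dD; pose g k l := 'X_l * D 'X_k - 'X_k * D 'X_l.
have gN k l : g l k = - g k l by rewrite /g opprB.
apply: der_ext => i; rewrite der_sumE.
under eq_bigr => k _ do rewrite der_sumE.
under eq_bigr => k _ do under eq_bigr => l _ do rewrite hamX -/(g k l).
under eq_bigr => k _ do rewrite sumrB.
rewrite sumrB [X in _ - X]exchange_big /=.
have part k : \sum_(l < n) (g k l)^`M(l) * (i == k)%:R =
    (i == k)%:R * (D 'X_k *+ (n + d) - D 'X_k).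
  by rewrite -mulr_suml mulrC (div0_homotopy k hD dD).
under eq_bigr => k _ do rewrite part.
have part' l : \sum_(k < n) (g k l)^`M(k) * (i == l)%:R =
    - ((i == l)%:R * (D 'X_l *+ (n + d) - D 'X_l)).
  rewrite -mulr_suml mulrC -mulrN; congr (_ * _).
  rewrite -(div0_homotopy l hD dD) -sumrN.
  by apply: eq_bigr => k _; rewrite -mderivN -/(g l k) -gN.
under [X in _ - X]eq_bigr => l _ do rewrite part'.
rewrite sumrN opprK -mulr2n.
by rewrite sum_delta /= scalerBl scaler_nat scale1r -mulr2n.
Qed.

End RaisingOperators.

(** * Irreducibility and the decomposition *)

Section Irreducibility.
Variables (K : fieldType) (charK : [pchar K] =i pred0) (n : nat).
Hypothesis n_ge2 : (2 <= n)%N.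
Local Notation W := (derivation K n).
Local Notation E := (euler K n).
Implicit Types (p q f : {mpoly K[n]}) (i j k a b l : 'I_n) (D F : W).

(** Annihilation by [x_k d_b] reads [x_k d_b D_i = (i == b) D_k].  So [D_k]
    depends on [x_k] alone, [D_k = c x_k^(d+1)], and for [i != k] the only
    variables of [D_i] are [x_k] and [x_i], with [d_i D_i = c x_k^d];
    integrating leaves a multiple of [x_k^(d+1)]. *)
Lemma killed_form d k D : (forall i, D 'X_i \is d.+1.-homog) ->
    (forall b, b != k -> lie (gl_unit K k b) D = 0) ->
  exists c (e : 'I_n -> K), e k = 0 /\
    forall i, D 'X_i = c *: 'X_k ^+ d * 'X_i + e i *: 'X_k ^+ d.+1.
Proof.
move=> hD kill.
have killX i b : b != k -> 'X_k * (D 'X_i)^`M(b) = (i == b)%:R * D 'X_k.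
  by move=> bk; apply/subr0_eq; rewrite -lie_gl_unitX kill.
have D_off i b : b != k -> i != b -> (D 'X_i)^`M(b) = 0.
  move=> bk ib; apply: (@XM_eq0 _ _ k).
  by rewrite killX // (negbTE ib) mul0r.
have [c Dk] : exists c, D 'X_k = c *: 'X_k ^+ d.+1.
  eexists; apply: (dhomog_one_variable charK (hD k)) => b bk.
  by apply: D_off => //; rewrite eq_sym.
have D_on b : b != k -> (D 'X_b)^`M(b) = c *: 'X_k ^+ d.
  move=> bk; apply/subr0_eq; apply: (@XM_eq0 _ _ k).
  rewrite mulrBr killX // eqxx mul1r Dk exprS.
  by rewrite -scalerAr subrr.
have tail i : exists e, (i == k -> e = 0) /\
    D 'X_i = c *: 'X_k ^+ d * 'X_i + e *: 'X_k ^+ d.+1.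
  have [-> | ik] := eqVneq i k.
    by exists 0; split=> //; rewrite scale0r addr0 -scalerAl -exprSr.
  pose h := D 'X_i - c *: 'X_k ^+ d * 'X_i.
  have hh : h \is d.+1.-homog.
    apply: rpredB => //; rewrite mulrC; apply: dhomogXM.
    by apply: dhomogZ; apply: dhomogXn.
  have Xkb b : b != k -> (c *: 'X_k ^+ d : {mpoly K[n]})^`M(b) = 0.
    move=> bk; rewrite mderivZ; case: (d) => [|d'].
      by rewrite expr0 dhomog0_mderiv ?dhomog1 ?scaler0.
    by rewrite mderivXn eq_sym (negbTE bk) mul0r mul0rn scaler0.
  have h0 b : b != k -> h^`M(b) = 0.
    move=> bk; rewrite mderivB mderivM Xkb // mul0r add0r mderivXU.
    have [<- | ib] := eqVneq i b; first by rewrite D_on // mulr1 subrr.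
    by rewrite D_off // mulr0 subr0.
  exists (h@_(U_(k) *+ d.+1)); split=> //.
  by rewrite -(dhomog_one_variable charK hh h0) addrC subrK.
have [e he] := fin_all_exists tail.
by exists c, e; split=> [|i]; [apply: (he k).1 | apply: (he i).2].
Qed.

(** Since [e k = 0], the second summand is divergence-free, and the divergence
    of the first is [(n + d) c x_k^d]. *)
Lemma killed_div0 d k D (c : K) (e : 'I_n -> K) : e k = 0 ->
    (forall i, D 'X_i = c *: 'X_k ^+ d * 'X_i + e i *: 'X_k ^+ d.+1) ->
  divergence D = 0 -> c = 0.
Proof.
move=> ek DX dD.
have : divergence D = (c *: 'X_k ^+ d) *+ (n + d).
  rewrite -(@divergence_euler_mul _ _ d); last first.
    by apply: dhomogZ; apply: dhomogXn.
  apply: eq_bigr => i _; rewrite DX der_mulE eulerX mderivD.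
  rewrite [(e i *: _)^`M(i)]mderivZ mderivXn.
  by case: (eqVneq k i) => [<- | _];
    rewrite ?ek ?scale0r ?mul0r ?mul0rn ?scaler0 addr0.
rewrite dD => /(congr1 (mcoeff (U_(k) *+ d))) /esym/eqP.
rewrite mcoeff0 mcoeffMn mcoeffZ mcoeffXn eqxx mulr1 -mulr_natr mulf_eq0.
by rewrite (negbTE (nat_gt0_neq0 charK _)) ?orbF => [/eqP // |]; lia.
Qed.

Lemma nonzero_elt (N : W -> Prop) : ~ (forall D, N D -> D = 0) ->
  exists2 D, N D & D <> 0.
Proof.
move/not_all_ex_not=> [D nD]; have [ND D0] := imply_to_and _ _ nD.
by exists D.
Qed.

Lemma W_euler_irreducible d :
  irreducible (W_comp 0) lie (W_euler (d.+1%:Z - 1) : W -> Prop).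
Proof.
have n_gt0 : (0 < n)%N by apply: leq_trans n_ge2.
pose k := Ordinal n_gt0.
have [Wsub WleW Wst] := W_euler_submodule K n d.+1.
split; first exact: lie_module_stable.
  exists (der_mul ('X_k ^+ d) E).
    by apply/W_eulerP => //; exists ('X_k ^+ d) => //; apply: dhomogXn.
  move/(congr1 (fun D : W => D 'X_k)); rewrite der_mulE eulerX der_zeroE.
  rewrite -exprSr => /(congr1 (mcoeff (U_(k) *+ d.+1))) /eqP.
  by rewrite mcoeffXn eqxx mcoeff0 oner_eq0.
move=> N [Nsub NleW Nst].
have [| /nonzero_elt[D ND D0]] := classic (forall D, N D -> D = 0).
  by left.
right.
have Nhom F : N F -> forall i, F 'X_i \is d.+1.-homog.
  by move=> /NleW/WleW/W_compP.
have Nunit a b F : N F -> N (lie (gl_unit K a b) F).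
  by apply: Nst; apply: gl_unit_W_comp.
have [F [NF F0 kill]] := exists_killed Nhom (Nunit k) ND D0.
have [f hf Ff] := (W_eulerP d F n_gt0).1 (NleW _ NF).
have [c [e [ek]]] := killed_form (Nhom _ NF) kill.
move/(_ k); rewrite ek scale0r addr0 Ff der_mulE eulerX mulrC [RHS]mulrC.
move/eqP; rewrite -subr_eq0 -mulrBr => /eqP/XM_eq0/subr0_eq fE.
have c0 : c != 0.
  apply/eqP=> c0; apply: F0; rewrite Ff fE c0 scale0r.
  by apply: der_ext => i; rewrite der_mulE mul0r.
have Nlin : linear (fun g => der_mul g E).
  by move=> ? ? ?; apply: der_mul_euler_linear.
move=> G /(W_eulerP d _ n_gt0)[g hg ->].
apply: (dhomog_generated charK (k := k) (subspace_preim Nsub Nlin)) hg.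
  suff -> : 'X_k ^+ d = c^-1 *: f.
    by apply: (subspaceZ (subspace_preim Nsub Nlin)); rewrite /= -Ff.
  by rewrite fE scalerA mulVf ?scale1r.
move=> a p ak hp Np.
by rewrite -gl_unitE -lie_euler_mul; [apply: Nunit | apply: gl_unit_W_comp].
Qed.

Lemma W_div0_irreducible d :
  irreducible (W_comp 0) lie (W_div0 (d.+1%:Z - 1) : W -> Prop).
Proof.
pose k0 := Ordinal (leq_trans (isT : (0 < 2)%N) n_ge2).
pose l0 := Ordinal (n_ge2 : (1 < n)%N).
have [Wsub WleW Wst] := W_div0_submodule K n d.+1.
split; first exact: lie_module_stable.
  exists (der_mul ('X_k0 ^+ d.+1) (partial K l0)).
    split.
      apply/W_compP=> i; rewrite der_mulE partialX.
      by case: (i == l0); rewrite ?mulr1 ?mulr0 ?dhomog0 // dhomogXn.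
    rewrite divergence_mul partialE mderivXn mul0r mul0rn addr0.
    rewrite /divergence big1 ?mulr0 // => i _; rewrite partialX.
    by case: (i == l0); rewrite ?linear0 // dhomog0_mderiv ?dhomog1.
  move/(congr1 (fun D : W => D 'X_l0)); rewrite der_mulE partialX eqxx.
  rewrite der_zeroE mulr1 => /(congr1 (mcoeff (U_(k0) *+ d.+1))) /eqP.
  by rewrite mcoeffXn eqxx mcoeff0 oner_eq0.
move=> N [Nsub NleW Nst].
have [| /nonzero_elt[D ND D0]] := classic (forall D, N D -> D = 0).
  by left.
right.
have Nhom F : N F -> forall i, F 'X_i \is d.+1.-homog.
  by move=> /NleW/WleW/W_compP.
have Nunit a b F : N F -> N (lie (gl_unit K a b) F).
  by apply: Nst; apply: gl_unit_W_comp.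
(* [k] is arbitrary here: the raising argument is run once for each variable. *)
have Npure k l : k != l -> N (der_mul ('X_k ^+ d.+1) (partial K l)).
  move=> kl.
  have [F [NF F0 kill]] := exists_killed Nhom (Nunit k) ND D0.
  have [c [e [ek FX]]] := killed_form (Nhom _ NF) kill.
  have [_ dF] := NleW _ NF.
  have c0 := killed_div0 ek FX dF.
  have {}FX i : F 'X_i = e i *: 'X_k ^+ d.+1.
    by rewrite FX c0 scale0r mul0r add0r.
  have [j ej] : exists j, e j != 0.
    apply: NNPP => /not_ex_all_not e0; apply: F0; apply: der_ext => i.
    by have /negP := e0 i; rewrite negbK FX => /eqP->; rewrite scale0r.
  suff -> : der_mul ('X_k ^+ d.+1) (partial K l)
          = (- (e j)^-1) *: lie (gl_unit K j l) F.
    by apply: subspaceZ => //; apply: Nunit.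
  apply: der_ext => i; rewrite der_mulE partialX der_scaleE lie_gl_unitX !FX.
  rewrite mderivZ mderivXn (negbTE kl) mul0r mul0rn scaler0 mulr0 sub0r.
  rewrite scalerN scaleNr opprK -scalerAr scalerA mulVf // scale1r.
  by rewrite mulrC.
have Nham k l f : f \is d.+2.-homog -> N (ham k l f).
  have [<- _ | kl] := eqVneq k l.
    by rewrite /ham subrr; apply: Nsub.1.
  move=> hf; have Hsub := subspace_preim Nsub (@ham_linear K n k l).
  apply: (dhomog_generated charK (k := k) Hsub _ _ hf).
    by rewrite ham_pure // -scaleNr; apply: subspaceZ => //; apply: Npure.
  by move=> a p ak hp Np; rewrite -lie_gl_unit_ham //; apply: Nunit.
move=> G [/W_compP hG dG].
(* [n + d = (n + d.+1) - 1] is the scalar of the homotopy formula. *)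
suff -> : G = (2%:R * (n + d)%:R)^-1 *: \sum_(k < n) \sum_(l < n)
            ham k l ('X_l * G 'X_k - 'X_k * G 'X_l).
  apply: subspaceZ => //; apply: subspace_sum => // k.
  apply: subspace_sum => // l; apply: Nham.
  by apply: rpredB; apply: dhomogXM.
rewrite (div0_sum_ham hG dG) addnS -[(n + d).+1%:R]natr1 addrK.
rewrite -scaler_nat !scalerA mulVf ?scale1r // mulf_neq0 ?nat_gt0_neq0 //; lia.
Qed.

(** [div (g E) = (n + d) g] recovers [g] from the divergence, so the component
    of [D] along [E] is [(n + d)^-1 (div D) E]. *)
Lemma W_comp_split d : direct_sum2 (@W_comp K n (d.+1%:Z - 1))
  (W_div0 (d.+1%:Z - 1)) (W_euler (d.+1%:Z - 1)).
Proof.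
have n_gt0 : (0 < n)%N by apply: leq_trans n_ge2.
have [Msub MleW _] := W_div0_submodule K n d.+1.
have [Nsub NleW _] := W_euler_submodule K n d.+1.
split=> // D WD.
have s_neq0 : ((n + d)%:R : K) != 0 by apply: nat_gt0_neq0 => //; lia.
pose f := ((n + d)%:R : K)^-1 *: divergence D.
have hf : f \is d.-homog.
  by apply: dhomogZ; apply: divergence_dhomog; apply/W_compP.
have Nf : W_euler (d.+1%:Z - 1) (der_mul f E).
  by apply/W_eulerP => //; exists f.
have dE g : g \is d.-homog ->
    divergence (der_mul g E) = (n + d)%:R *: g.
  by move=> hg; rewrite (divergence_euler_mul hg) scaler_nat.
exists (D - der_mul f E, der_mul f E); split=> [/=|].
  split=> //; last by rewrite subrK.
  have -> : D - der_mul f E = -1 *: der_mul f E + D by rewrite addrC scaleN1r.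
  split; first by apply: (W_comp_subspace K n d.+1).2 => //; apply: NleW.
  rewrite divergence_linear (dE f) // scalerA mulN1r.
  by rewrite scaleNr /f scalerA divff // scale1r addNr.
move=> [D1 D2] /= [[_ dD1] /W_eulerP[//|g hg D2g] Dsum].
have gf : g = f.
  rewrite /f Dsum -[D1]scale1r divergence_linear dD1 scaler0 add0r D2g.
  by rewrite (dE g hg) scalerA mulVf // scale1r.
by rewrite Dsum D2g gf addrK.
Qed.

End Irreducibility.

Theorem theorem1 (K : closedFieldType) (charK : [pchar K] =i pred0)
    (n : nat) (n_ge2 : (2 <= n)%N) :
  let L : derivation K n -> Prop := @W_comp K n 0 in
  [/\ direct_sum_family (fun d : nat => @W_comp K n (d%:Z - 1)),
      lie_subalgebra L,
      lie_isomorphic L 'M[K]_n,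
      forall m : int, -1 <= m ->
        lie_module L lie (@W_comp K n m) /\ finite_dimensional (@W_comp K n m)
    & forall m : int, 0 <= m ->
        [/\ direct_sum2 (@W_comp K n m) (@W_div0 K n m) (@W_euler K n m),
            lie_submodule L lie (@W_comp K n m) (@W_div0 K n m),
            lie_submodule L lie (@W_comp K n m) (@W_euler K n m),
            irreducible L lie (@W_div0 K n m)
          & irreducible L lie (@W_euler K n m)]].
Proof.
split.
- exact: W_comp_direct_sum.
- by split; [apply: (W_comp_subspace K n 1) | apply: (@W_comp_lie K n 1)].
- exact: W_comp0_gl.
- move=> m m_ge; have [d ->] : exists d : nat, m = d%:Z - 1.
    by exists (absz (m + 1)); lia.
  split; last exact: W_comp_finite_dimensional.
  apply: lie_module_stable; first exact: W_comp_subspace.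
  exact: W_comp_lie.
move=> m m_ge; have [d ->] : exists d : nat, m = d.+1%:Z - 1.
  by exists (absz m); lia.
split.
- exact: W_comp_split.
- exact: W_div0_submodule.
- exact: W_euler_submodule.
- exact: W_div0_irreducible.
- exact: W_euler_irreducible.
Qed.
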